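(* Let $n\ge3$. The algebras $\mathbb{O}_n$ and $\mathbb{M}_n$, and the algebras $\mathbb{O}_{p,q}$ and $\mathbb{M}_{p,q}$ with $p+q=n$, are the only non-associative twisted $(\mathbb{Z}_2)^n$-algebras (twisted group algebras over $(\mathbb{Z}_2)^n$) over the field of scalars $\mathbb{C}$ or $\mathbb{R}$ that admit an $\mathfrak{S}_n$-invariant generating function.
   Context: For $\mathbb{K}=\mathbb{R}$ or $\mathbb{C}$ and $f:(\mathbb{Z}_2)^n\times(\mathbb{Z}_2)^n\to\mathbb{Z}_2$ with $f(0,\cdot)=f(\cdot,0)=0$, the twisted group algebra $(\mathbb{K}[(\mathbb{Z}_2)^n],f)$ is the $\mathbb{K}$-algebra with basis $u_x$, $x\in(\mathbb{Z}_2)^n$, and product $u_x\cdot u_y=(-1)^{f(x,y)}u_{x+y}$. Set $\beta(x,y)=f(x,y)+f(y,x)$ and $\phi(x,y,z)=f(y,z)+f(x+y,z)+f(x,y+z)+f(x,y)$. A function $\alpha:(\mathbb{Z}_2)^n\to\mathbb{Z}_2$ is a generating function of the algebra if for all $x,y,z$: $\beta(x,y)=\alpha(x+y)+\alpha(x)+\alpha(y)$ and $\phi(x,y,z)=\alpha(x+y+z)+\alpha(x+y)+\alpha(x+z)+\alpha(y+z)+\alpha(x)+\alpha(y)+\alpha(z)$. The symmetric group $\mathfrak{S}_n$ acts on $(\mathbb{Z}_2)^n$ by permuting coordinates; $\alpha$ is $\mathfrak{S}_n$-invariant if $\alpha\circ\sigma=\alpha$ for all $\sigma\in\mathfrak{S}_n$.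 Put $$f_{\mathbb{M}}(x,y)=\sum_{1\le i<j<k\le n}(x_ix_jy_k+x_iy_jx_k+y_ix_jx_k),\qquad f_{\mathbb{O}}(x,y)=f_{\mathbb{M}}(x,y)+\sum_{1\le i\le j\le n}x_iy_j .$$ Then $\mathbb{O}_n=(\mathbb{C}[(\mathbb{Z}_2)^n],f_{\mathbb{O}})$ and $\mathbb{M}_n=(\mathbb{C}[(\mathbb{Z}_2)^n],f_{\mathbb{M}})$ are complex algebras, and for $p+q=n$ the real algebras are $\mathbb{O}_{p,q}=(\mathbb{R}[(\mathbb{Z}_2)^n],\,f_{\mathbb{O}}+\sum_{1\le i\le p}x_iy_i)$ and $\mathbb{M}_{p,q}=(\mathbb{R}[(\mathbb{Z}_2)^n],\,f_{\mathbb{M}}+\sum_{1\le i\le p}x_iy_i)$. *)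

(* Defs.v *)
From HB Require Import structures.
From mathcomp Require Import all_boot all_order all_fingroup all_algebra.
From mathcomp Require Import reals.
From mathcomp Require Import complex.

Set Implicit Arguments.
Unset Strict Implicit.
Unset Printing Implicit Defensive.

Import Order.TTheory GRing.Theory Num.Theory.

Local Open Scope ring_scope.

Section Twists.
Variable n : nat.
Notation V := 'rV['F_2]_n.
Implicit Types (f : V -> V -> 'F_2) (alpha : V -> 'F_2).

Definition is_twist f : Prop :=
  (forall x, f 0 x = 0) /\ (forall x, f x 0 = 0).

Definition beta f (x y : V) : 'F_2 := f x y + f y x.

Definition phi f (x y z : V) : 'F_2 :=
  f y z + f (x + y) z + f x (y + z) + f x y.

Definition generating_function f alpha : Prop :=
  (forall x y, beta f x y = alpha (x + y) + alpha x + alpha y) /\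
  (forall x y z, phi f x y z =
     alpha (x + y + z) + alpha (x + y) + alpha (x + z) + alpha (y + z)
     + alpha x + alpha y + alpha z).

Definition Sn_invariant alpha : Prop :=
  forall (s : 'S_n) (x : V), alpha (col_perm s x) = alpha x.

Definition f_M (x y : V) : 'F_2 :=
  \sum_(i < n) \sum_(j < n | (i < j)%N) \sum_(k < n | (j < k)%N)
    (x 0 i * x 0 j * y 0 k + x 0 i * y 0 j * x 0 k + y 0 i * x 0 j * x 0 k).

Definition f_O (x y : V) : 'F_2 :=
  f_M x y + \sum_(i < n) \sum_(j < n | (i <= j)%N) x 0 i * y 0 j.

(* The twists of M_{p,q} and O_{p,q}, where q = n - p. Ordinals count from 0,
   so i < p selects the first p coordinates. *)
Definition f_Mp (p : nat) (x y : V) : 'F_2 :=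
  f_M x y + \sum_(i < n | (i < p)%N) x 0 i * y 0 i.

Definition f_Op (p : nat) (x y : V) : 'F_2 :=
  f_O x y + \sum_(i < n | (i < p)%N) x 0 i * y 0 i.

End Twists.

(* Elements are the families of coordinates in the basis (u_x). The twist is a
   phantom parameter: it only enters through the product [tga_mul]. *)
Definition tga (K : fieldType) (n : nat)
    (f : 'rV['F_2]_n -> 'rV['F_2]_n -> 'F_2) : Type :=
  {ffun 'rV['F_2]_n -> K^o}.

HB.instance Definition _ (K : fieldType) n
    (f : 'rV['F_2]_n -> 'rV['F_2]_n -> 'F_2) :=
  GRing.Lmodule.copy (tga K f) {ffun 'rV['F_2]_n -> K^o}.

Section TwistedGroupAlgebra.
Variables (K : fieldType) (n : nat).
Notation V := 'rV['F_2]_n.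
Implicit Types f g : V -> V -> 'F_2.

Definition tga_coord f (a : tga K f) (x : V) : K := (a : {ffun V -> K^o}) x.

Definition tga_basis f (x : V) : tga K f := [ffun y => (y == x)%:R : K^o].

(* The bilinear extension of u_x u_y = (-1)^{f(x,y)} u_{x+y}. *)
Definition tga_mul f (a b : tga K f) : tga K f :=
  \sum_(x : V) \sum_(y : V)
    (tga_coord a x * tga_coord b y * (-1) ^+ (f x y : nat))
      *: tga_basis f (x + y).

Definition nonassociative f : Prop := ~ associative (@tga_mul f).

(* Isomorphism of graded algebras: the degrees may be relabelled, but each line
   K u_x must be sent to a line K u_y. *)
Definition tga_isomorphic f g : Prop :=
  exists theta : {linear tga K f -> tga K g},
    [/\ bijective theta,
        {morph theta : a b / tga_mul a b >-> tga_mul a b} &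
        forall x, exists y (c : K),
          theta (tga_basis f x) = c *: tga_basis g y].

Definition nonassociative_with_invariant_generating_function f : Prop :=
  [/\ is_twist f,
      nonassociative f &
      exists2 alpha, generating_function f alpha & Sn_invariant alpha].

End TwistedGroupAlgebra.

(* Main.v *)
(* The fourth polarization of a generating function vanishes, because phi is a
   coboundary; so a generating function is a cubic polynomial. A symmetric one
   depends only on the Hamming weight, hence is a combination of the elementary
   symmetric functions e1, e2, e3. The coefficient of e1 is invisible in beta
   and phi, and that of e3 is nonzero when the algebra is not associative; the
   coefficient of e2 then says whether f has the beta and phi of f_O or of f_M.
   Two twists with the same beta and phi differ by a symmetric 2-cocycle, whose
   class is detected by its values at (e_i, e_i). Over C these signs can be
   rescaled away; over R they are matched, after a permutation of coordinates,
   by the p terms x_i y_i. *)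

Require Import Defs.
From Stdlib Require Import Ring.
From HB Require Import structures.
From mathcomp Require Import all_boot all_order all_fingroup all_algebra.
From mathcomp Require Import reals.
From mathcomp Require Import complex.

Import Order.TTheory GRing.Theory Num.Theory.

Local Open Scope ring_scope.

Set Implicit Arguments.
Unset Strict Implicit.
Unset Printing Implicit Defensive.

(** * Identities in characteristic two *)

Lemma F2_ind (P : 'F_2 -> Prop) : P 0 -> P 1 -> forall a, P a.
Proof.
move=> P0 P1 [[|[|//]] h].
- by have -> : Ordinal h = 0 by exact: val_inj.
- by have -> : Ordinal h = 1 by exact: val_inj.
Qed.

Lemma addF2xx (a : 'F_2) : a + a = 0.
Proof. exact: (addrr_pchar2 (pchar_Fp (isT : prime 2))). Qed.

(* The Stdlib [ring] tactic, with coefficients in [bool], normalizes modulo 2.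
   It needs a syntactically rigid carrier and operations, hence these copies. *)
Definition F2 : Type := 'F_2.
Definition addF2 : F2 -> F2 -> F2 := @GRing.add 'F_2.
Definition mulF2 : F2 -> F2 -> F2 := @GRing.mul 'F_2.
Definition zeroF2 : F2 := 0 : 'F_2.
Definition oneF2 : F2 := 1 : 'F_2.
Definition addrv n : 'rV['F_2]_n -> 'rV['F_2]_n -> 'rV['F_2]_n := +%R.
Definition zerov n : 'rV['F_2]_n := 0.
Definition oppF2 : F2 -> F2 := id.
Definition F2_of_bool (b : bool) : F2 := if b then oneF2 else zeroF2.

Lemma addF2E (a b : 'F_2) : a + b = addF2 a b. Proof. by []. Qed.
Lemma mulF2E (a b : 'F_2) : a * b = mulF2 a b. Proof. by []. Qed.
Lemma zerovE n : 0 = zerov n. Proof. by []. Qed.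
Lemma zeroF2E : 0 = zeroF2. Proof. by []. Qed.
Lemma oneF2E : 1 = oneF2. Proof. by []. Qed.
Lemma addrvE n (x y : 'rV['F_2]_n) : x + y = addrv x y. Proof. by []. Qed.

Lemma F2_ring_theory : ring_theory zeroF2 oneF2 addF2 mulF2 addF2 oppF2 eq.
Proof.
split=> *; rewrite /addF2 /mulF2 ?add0r ?mul1r ?addrA ?mulrA ?mulrDl //.
- exact: addrC.
- exact: mulrC.
- exact: addF2xx.
Qed.

Lemma F2_of_bool_morph :
  ring_morph zeroF2 oneF2 addF2 mulF2 addF2 oppF2 eq
    false true addb andb addb id eqb F2_of_bool.
Proof. by split=> // -[] // -[] //; exact: val_inj. Qed.

Ltac F2_constant t :=
  match t with
  | zeroF2 => constr:(false)
  | oneF2 => constr:(true)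
  | _ => constr:(NotConstant)
  end.

Add Ring F2_ring :
  F2_ring_theory (morphism F2_of_bool_morph, constants [F2_constant]).

(** The working form of linear combination: adding a known equation [l = r] to a goal leaves an
    identity that [char2] can decide, and successive uses add several equations. *)
Lemma F2_lincomb (l r a b : 'F_2) : l = r -> a + b = l + r -> a = b.
Proof.
move=> -> ab; have {}ab : a + b = 0 by rewrite ab addF2xx.
by rewrite -[a]addr0 -(addF2xx b) addrA ab add0r.
Qed.

Lemma eqF2 (a b : 'F_2) : addF2 a b = zeroF2 -> a = b.
Proof. by move=> ab; apply: (F2_lincomb (erefl 0)); rewrite addr0; exact: ab. Qed.

Ltac char2 :=
  apply: eqF2;
  rewrite ?zerovE ?addrvE ?zeroF2E ?oneF2E ?addF2E ?mulF2E; ring.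

Lemma F2_natr (a : 'F_2) : (a : nat)%:R = a.
Proof. by elim/F2_ind: a; exact: val_inj. Qed.

Lemma mulF2_xx (a : 'F_2) : a * a = a.
Proof. by elim/F2_ind: a; exact: val_inj. Qed.

(** * Generating functions *)

Section GeneratingFunctions.
Variable n : nat.
Notation V := 'rV['F_2]_n.
Implicit Types (f g : V -> V -> 'F_2) (alpha : V -> 'F_2) (x y z t : V).

Definition polar2 alpha x y := alpha (x + y) + alpha x + alpha y.

(** The polarization of [polar2] in one argument, with repeated terms cancelled modulo 2. *)
Definition polar3 alpha x y z :=
  alpha (x + y + z) + alpha (x + y) + alpha (x + z) + alpha (y + z)
  + alpha x + alpha y + alpha z.

Definition polar4 alpha x y z t :=
  polar3 alpha (x + y) z t + polar3 alpha x z t + polar3 alpha y z t.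

(** [phi] is the coboundary of the 2-cochain [f], and a coboundary has zero coboundary. *)
Lemma phi_cocycle f x y z t :
  phi f y z t + phi f (x + y) z t + phi f x (y + z) t + phi f x y (z + t)
  + phi f x y z = 0.
Proof.
(* [char2] sees the values of [f] as atoms, so sums of vectors must first be bracketed alike. *)
by rewrite /phi (addrA x y z) (addrA y z t); char2.
Qed.

(* Symmetry of [polar3 alpha] turns the cocycle identity of [phi] into the
   vanishing of the fourth polarization: a generating function is cubic. *)
Lemma generating_cubic f alpha x y z t :
  generating_function f alpha -> polar4 alpha x y z t = 0.
Proof.
move=> [_ Hphi]; have := phi_cocycle f x y z t.
rewrite !Hphi => H; apply: (F2_lincomb H).
by rewrite /polar4 /polar3 !addrA; char2.
Qed.

(** At the origin the condition on [phi] has seven equal terms on the right, an odd number. *)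
Lemma generating0 f alpha :
  is_twist f -> generating_function f alpha -> alpha 0 = 0.
Proof.
move=> [f0 _] [_ Hphi]; have := Hphi 0 0 0.
by rewrite /phi !addr0 !f0 => H; apply: (F2_lincomb H); char2.
Qed.

Lemma generating_add f g alpha gamma :
    generating_function f alpha -> generating_function g gamma ->
  generating_function (fun x y => f x y + g x y) (fun x => alpha x + gamma x).
Proof.
move=> [bf pf] [bg pg]; split=> [x y|x y z].
  transitivity (beta f x y + beta g x y); last by rewrite bf bg; char2.
  by rewrite /beta; char2.
transitivity (phi f x y z + phi g x y z); last by rewrite pf pg; char2.
by rewrite /phi; char2.
Qed.

Lemma generating_sum I (r : seq I) (P : pred I) (F : I -> V -> V -> 'F_2)
    (A : I -> V -> 'F_2) :
    (forall i, generating_function (F i) (A i)) ->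
  generating_function (fun x y => \sum_(i <- r | P i) F i x y)
                      (fun x => \sum_(i <- r | P i) A i x).
Proof.
move=> genF; split=> [x y|x y z]; rewrite /beta /phi -!big_split /=.
  by apply: eq_bigr => i _; exact: (proj1 (genF i)).
by apply: eq_bigr => i _; exact: (proj2 (genF i)).
Qed.

Definition biadditive (b : V -> V -> 'F_2) :=
  (forall x y z, b (x + y) z = b x z + b y z) /\
  (forall x y z, b x (y + z) = b x y + b x z).

(** Here [beta] is the polarization of the quadratic form [b x x], and both [phi] and the third
    polarization vanish. *)
Lemma generating_biadditive (b : V -> V -> 'F_2) :
  biadditive b -> generating_function b (fun x => b x x).
Proof.
by move=> [bl br]; split=> [x y|x y z]; rewrite /beta /phi !(bl, br); char2.
Qed.

Lemma coordD x y i : (x + y) 0 i = x 0 i + y 0 i.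
Proof. by rewrite mxE. Qed.

(** The condition is additive in the pair of twist and function, so one triple [i], [j], [k]
    suffices; there it is a polynomial identity in the coordinates. *)
Lemma f_M_generating : generating_function (@f_M n) (fun x => f_M x x).
Proof.
apply: generating_sum => i; apply: generating_sum => j.
apply: generating_sum => k.
by split=> *; rewrite /beta /phi !coordD; char2.
Qed.

Lemma biadditive_sum I (r : seq I) (P : pred I) (F : I -> V -> V -> 'F_2) :
    (forall i, biadditive (F i)) ->
  biadditive (fun x y => \sum_(i <- r | P i) F i x y).
Proof.
move=> FP; split=> x y z; rewrite -big_split /=; apply: eq_bigr => i _.
  by case: (FP i) => ->.
by case: (FP i) => _ ->.
Qed.

Lemma biadditive_coord i j : biadditive (fun x y => x 0 i * y 0 j).
Proof. by split=> x y z; rewrite coordD ?mulrDl ?mulrDr. Qed.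

Definition triangular_form (x y : V) : 'F_2 :=
  \sum_(i < n) \sum_(j < n | (i <= j)%N) x 0 i * y 0 j.

Definition diagonal_form p (x y : V) : 'F_2 :=
  \sum_(i < n | (i < p)%N) x 0 i * y 0 i.

Lemma triangular_form_biadditive : biadditive triangular_form.
Proof.
by apply: biadditive_sum => i; apply: biadditive_sum => j; exact: biadditive_coord.
Qed.

Lemma diagonal_form_biadditive p : biadditive (diagonal_form p).
Proof. by apply: biadditive_sum => i; exact: biadditive_coord. Qed.

Lemma f_O_generating : generating_function (@f_O n) (fun x => f_O x x).
Proof.
apply: generating_add; first exact: f_M_generating.
exact: (generating_biadditive triangular_form_biadditive).
Qed.

Lemma biadditive_phi (b : V -> V -> 'F_2) x y z : biadditive b -> phi b x y z = 0.
Proof. by move=> [bl br]; rewrite /phi bl br; char2. Qed.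

Lemma phi_add f g x y z :
  phi (fun x y => f x y + g x y) x y z = phi f x y z + phi g x y z.
Proof. by rewrite /phi; char2. Qed.

Lemma phi_f_O x y z : phi (@f_O n) x y z = phi (@f_M n) x y z.
Proof.
by rewrite phi_add (biadditive_phi _ _ _ triangular_form_biadditive) addr0.
Qed.

(** A symmetric biadditive form changes neither [beta] nor [phi], so a generating function cannot
    see [p]. *)
Lemma generating_diagonal p f alpha :
    generating_function f alpha ->
  generating_function (fun x y => f x y + diagonal_form p x y) alpha.
Proof.
have [dl dr] := diagonal_form_biadditive p; move=> [bf pf]; split=> [x y|x y z].
  rewrite -bf /beta.
  rewrite (_ : diagonal_form p y x = diagonal_form p x y); first by char2.
  by apply: eq_bigr => i _; rewrite mulrC.
by rewrite -pf phi_add (biadditive_phi _ _ _ (diagonal_form_biadditive p)) addr0.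
Qed.

Lemma biadditive_twist (b : V -> V -> 'F_2) : biadditive b -> is_twist b.
Proof.
move=> [bl br]; split=> x.
  by apply: (F2_lincomb (bl 0 0 x)); rewrite (addr0 0); char2.
by apply: (F2_lincomb (br x 0 0)); rewrite (addr0 0); char2.
Qed.

Lemma twist_add f g : is_twist f -> is_twist g ->
  is_twist (fun x y => f x y + g x y).
Proof. by move=> [f0 f0'] [g0 g0']; split=> x; rewrite ?(f0, f0', g0, g0') addr0. Qed.

Lemma f_M_twist : is_twist (@f_M n).
Proof.
split=> x; rewrite /f_M; do 3 (rewrite big1 // => ? _);
  by rewrite !mxE; char2.
Qed.

Lemma f_O_twist : is_twist (@f_O n).
Proof. exact: twist_add f_M_twist (biadditive_twist triangular_form_biadditive). Qed.

Lemma additive_eq0 (h : V -> 'F_2) :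
    (forall x y, h (x + y) = h x + h y) ->
    (forall i, h (delta_mx 0 i) = 0) -> forall x, h x = 0.
Proof.
move=> hD h0 x.
have h00 : h 0 = 0 by apply: (F2_lincomb (hD 0 0)); rewrite (addr0 0); char2.
rewrite (row_sum_delta x).
elim: (index_enum _) => [|i r IH]; first by rewrite big_nil.
rewrite big_cons hD IH addr0.
by elim/F2_ind: (x 0 i); rewrite ?scale0r ?scale1r.
Qed.

End GeneratingFunctions.

(** * Hamming weight and symmetric cubic functions *)

Definition weight n (x : 'rV['F_2]_n) : nat := (\sum_(i < n) (x 0%R i : nat))%N.

Lemma F2_nat_le1 (a : 'F_2) : (a <= 1)%N.
Proof. by elim/F2_ind: a. Qed.

Lemma weight_le n (x : 'rV['F_2]_n) : (weight x <= n)%N.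
Proof.
rewrite -[leqRHS]card_ord -sum1_card.
by apply: leq_sum => i _; exact: F2_nat_le1.
Qed.

Lemma weight_col_perm n (s : 'S_n) (x : 'rV['F_2]_n) :
  weight (col_perm s x) = weight x.
Proof.
rewrite /weight [RHS](reindex_inj (@perm_inj _ s)).
by apply: eq_bigr => i _; rewrite mxE.
Qed.

Lemma weightD n (x y : 'rV['F_2]_n) : (weight (x + y) <= weight x + weight y)%N.
Proof.
rewrite /weight -big_split; apply: leq_sum => i _; rewrite coordD.
by elim/F2_ind: (x 0 i); elim/F2_ind: (y 0 i).
Qed.

Lemma weight_delta n (i : 'I_n) : weight (delta_mx 0 i) = 1%N.
Proof.
rewrite /weight (bigD1 i) //= mxE !eqxx big1 // => j ji.
by rewrite mxE (negbTE ji).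
Qed.

(** The chosen representative of the vectors of weight [w]; it is also the indicator of the first
    coordinates in the diagonal term. *)
Definition initial_vector n (w : nat) : 'rV['F_2]_n := \row_i (i < w)%N%:R.

Lemma weight_initial_vector n w : (w <= n)%N -> weight (initial_vector n w) = w.
Proof.
move=> wn; rewrite /weight.
transitivity (\sum_(i < n | (i < w)%N) 1)%N; last first.
  by rewrite -(big_ord_widen _ (fun=> 1%N)) // sum1_card card_ord.
by rewrite [RHS]big_mkcond; apply: eq_bigr => i _; rewrite mxE; case: ifP.
Qed.

(** The weight fixes how often 1 occurs, hence also 0, so the two tuples of entries are
    rearrangements of each other. *)
Lemma same_weight_perm n (x y : 'rV['F_2]_n) :
  weight x = weight y -> exists s : 'S_n, x = col_perm s y.
Proof.
pose u (z : 'rV['F_2]_n) := [tuple z 0 i | i < n].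
have count1 z : count_mem 1 (u z) = weight z.
  rewrite -sum1_count big_map big_enum_cond big_mkcond; apply: eq_bigr => i _.
  by elim/F2_ind: (z 0 i).
have count0 z : count_mem 0 (u z) = (n - weight z)%N.
  rewrite -(count1 z) -[X in (X - _)%N](size_tuple (u z)).
  rewrite -(count_predC (pred1 1)) addKn; apply: eq_count => a.
  by elim/F2_ind: a.
move=> xy; have /tuple_permP[s us] : perm_eq (u x) (u y).
  by apply/allP => a _; elim/F2_ind: a => /=; rewrite ?count0 ?count1 xy eqxx.
exists s; apply/rowP => i; rewrite mxE.
have -> : x 0 i = tnth (u x) i by rewrite tnth_mktuple.
rewrite (_ : u x = [tuple tnth (u y) (s i) | i < n]); last exact: val_inj.
by rewrite !tnth_mktuple.
Qed.

(** * Elementary symmetric functions modulo two *)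

Lemma big_ord_lt0 n (F : 'I_n.+1 -> 'F_2) :
  \sum_(j < n.+1 | ((ord0 : 'I_n.+1) < j)%N) F j = \sum_(j < n) F (lift ord0 j).
Proof. by rewrite big_mkcond big_ord_recl /= add0r. Qed.

Lemma big_ord_ltS n (i : 'I_n) (F : 'I_n.+1 -> 'F_2) :
  \sum_(j < n.+1 | (lift ord0 i < j)%N) F j
  = \sum_(j < n | (i < j)%N) F (lift ord0 j).
Proof. by rewrite big_mkcond big_ord_recl /= add0r [RHS]big_mkcond. Qed.

Lemma elementary1 n (a : 'I_n -> 'F_2) :
  \sum_(i < n) a i = (\sum_(i < n) (a i : nat))%N%:R.
Proof. by rewrite natr_sum; apply: eq_bigr => i _; rewrite F2_natr. Qed.

(** The sum counts pairs of ones; splitting off the first variable is Pascal's rule. *)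
Lemma elementary2 n (a : 'I_n -> 'F_2) :
  \sum_(i < n) \sum_(j < n | (i < j)%N) a i * a j
  = 'C((\sum_(i < n) (a i : nat))%N, 2)%:R.
Proof.
elim: n a => [|n IH] a; first by rewrite !big_ord0.
rewrite [in RHS]big_ord_recl big_ord_recl big_ord_lt0 -mulr_sumr.
under [X in _ + X = _]eq_bigr do rewrite big_ord_ltS.
rewrite IH elementary1.
by elim/F2_ind: (a ord0); rewrite ?mul0r ?mul1r ?add0r // add1n binS bin1 natrD addrC.
Qed.

Lemma elementary3 n (a : 'I_n -> 'F_2) :
  \sum_(i < n) \sum_(j < n | (i < j)%N) \sum_(k < n | (j < k)%N) a i * a j * a k
  = 'C((\sum_(i < n) (a i : nat))%N, 3)%:R.
Proof.
elim: n a => [|n IH] a; first by rewrite !big_ord0.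
rewrite [in RHS]big_ord_recl big_ord_recl big_ord_lt0.
under [X in X + _ = _]eq_bigr do [rewrite big_ord_ltS; under eq_bigr do rewrite -mulrA].
under [X in _ + X = _]eq_bigr do
  [rewrite big_ord_ltS; under eq_bigr do rewrite big_ord_ltS].
rewrite IH.
under [X in X + _ = _]eq_bigr do rewrite -mulr_sumr.
rewrite -mulr_sumr elementary2.
by elim/F2_ind: (a ord0); rewrite ?mul0r ?mul1r ?add0r // add1n binS natrD addrC.
Qed.

Lemma f_M_diag n (x : 'rV['F_2]_n) : f_M x x = 'C(weight x, 3)%:R.
Proof.
rewrite -(elementary3 (x 0)); apply: eq_bigr => i _; apply: eq_bigr => j _.
by apply: eq_bigr => k _; char2.
Qed.

(** The terms with [i = j] are squares, hence linear over the field with two elements, and give the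
    weight; those with [i < j] give the binomial of order two. *)
Lemma f_O_diag n (x : 'rV['F_2]_n) :
  f_O x x = 'C(weight x, 3)%:R + 'C(weight x, 2)%:R + (weight x)%:R.
Proof.
rewrite /f_O f_M_diag -addrA; congr (_ + _).
rewrite -(elementary2 (x 0)) -(elementary1 (x 0)) -big_split /=.
apply: eq_bigr => i _; rewrite (bigD1 i) //= mulF2_xx addrC; congr (_ + _).
by apply: eq_bigl => j; rewrite ltn_neqAle andbC eq_sym.
Qed.

Lemma f_M_invariant n : @Sn_invariant n (fun x => f_M x x).
Proof. by move=> s x; rewrite !f_M_diag weight_col_perm. Qed.

Lemma f_O_invariant n : @Sn_invariant n (fun x => f_O x x).
Proof. by move=> s x; rewrite !f_O_diag weight_col_perm. Qed.

(** * Cubic functions are determined by their values in weight at most three *)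

Section CubicFunctions.
Variable n : nat.
Notation V := 'rV['F_2]_n.
Implicit Types (f g : V -> V -> 'F_2) (alpha gamma : V -> 'F_2) (x y z t : V).

Definition parity x : 'F_2 := \sum_(i < n) x 0 i.

Lemma parityD x y : parity (x + y) = parity x + parity y.
Proof. by rewrite /parity -big_split; apply: eq_bigr => i _; rewrite coordD. Qed.

Lemma parity_weight x : parity x = (weight x)%:R.
Proof. exact: elementary1. Qed.

Lemma invariant_weight alpha x y :
  Sn_invariant alpha -> weight x = weight y -> alpha x = alpha y.
Proof. by move=> inv /same_weight_perm[s ->]; exact: inv. Qed.

(** The degree drops step by step: [polar3] is additive in each argument and zero on basis vectors,
    hence zero; then the same holds for [polar2], and finally for [gamma]. *)
Lemma cubic_eq0 gamma :
    (forall x y z t, polar4 gamma x y z t = 0) ->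
    (forall x, (weight x <= 3)%N -> gamma x = 0) ->
  forall x, gamma x = 0.
Proof.
move=> cub small.
have small2 x y : (weight x + weight y <= 3)%N -> gamma (x + y) = 0.
  by move=> h; apply: small; apply: leq_trans h; exact: weightD.
have small3 x y z : (weight x + weight y + weight z <= 3)%N ->
    gamma (x + y + z) = 0.
  move=> h; apply: small2; apply: leq_trans h.
  by rewrite leq_add2r weightD.
have D3l u v y z : polar3 gamma (u + v) y z =
    polar3 gamma u y z + polar3 gamma v y z.
  by apply: (F2_lincomb (cub u v y z)); rewrite /polar4; char2.
have D3_12 u v y : polar3 gamma u v y = polar3 gamma v u y.
  by rewrite /polar3 (addrC v u); char2.
have D3_23 u v y : polar3 gamma u v y = polar3 gamma u y v.
  by rewrite /polar3 (addrAC u y v) (addrC y v); char2.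
have D3 x y z : polar3 gamma x y z = 0.
  move: x; apply: (@additive_eq0 n) => [u v|i]; first exact: D3l.
  (* Symmetry brings each argument in turn to the first place, where additivity is known. *)
  rewrite D3_12; move: y; apply: (@additive_eq0 n) => [u v|j]; first exact: D3l.
  rewrite D3_23 D3_12; move: z; apply: (@additive_eq0 n) => [u v|k].
    exact: D3l.
  by rewrite /polar3 ?(small3, small2, small) ?weight_delta ?addr0.
have D2l u v y : polar2 gamma (u + v) y = polar2 gamma u y + polar2 gamma v y.
  by apply: (F2_lincomb (D3 u v y)); rewrite /polar2 /polar3; char2.
have D2_12 u v : polar2 gamma u v = polar2 gamma v u.
  by rewrite /polar2 (addrC v u); char2.
have D2 x y : polar2 gamma x y = 0.
  move: x; apply: (@additive_eq0 n) => [u v|i]; first exact: D2l.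
  rewrite D2_12; move: y; apply: (@additive_eq0 n) => [u v|j]; first exact: D2l.
  by rewrite /polar2 ?(small2, small) ?weight_delta ?addr0.
apply: (@additive_eq0 n) => [x y|i]; last by rewrite small ?weight_delta.
by apply: (F2_lincomb (D2 x y)); rewrite /polar2; char2.
Qed.

End CubicFunctions.

(** * Classification of the invariant generating functions *)

Section Classification.
Variable n : nat.
Notation V := 'rV['F_2]_n.
Implicit Types (f g : V -> V -> 'F_2) (alpha : V -> 'F_2) (x y z : V).

Definition f_base (b : bool) : V -> V -> 'F_2 := if b then @f_O n else @f_M n.

Lemma f_base_twist b : is_twist (f_base b).
Proof. by case: b; [exact: f_O_twist | exact: f_M_twist]. Qed.

Lemma f_base_generating b :
  generating_function (f_base b) (fun x => f_base b x x).
Proof. by case: b; [exact: f_O_generating | exact: f_M_generating]. Qed.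

Lemma f_base_invariant b : Sn_invariant (fun x => f_base b x x).
Proof. by case: b; [exact: f_O_invariant | exact: f_M_invariant]. Qed.

Lemma invariant_cubic_decomposition alpha :
    (3 <= n)%N -> alpha 0 = 0 -> Sn_invariant alpha ->
    (forall x y z t, polar4 alpha x y z t = 0) ->
  exists d1 d2 d3, forall x,
    alpha x = d1 * parity x + d2 * f_O x x + d3 * f_M x x.
Proof.
move=> n3 alpha0 inv cub.
pose a k := alpha (initial_vector n k).
have alphaE x : alpha x = a (weight x).
  by apply: invariant_weight => //; rewrite weight_initial_vector ?weight_le.
(* In weights 1, 2, 3 the function [parity] takes the values 1, 0, 1, the diagonal of [f_O] takes 1,
   1, 1 and that of [f_M] takes 0, 0, 1; these coefficients solve the resulting system. *)
pose d1 := a 1%N + a 2%N; pose d2 := a 2%N; pose d3 := a 1%N + a 3%N.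
pose gamma x := alpha x + (d1 * parity x + d2 * f_O x x + d3 * f_M x x).
exists d1, d2, d3 => x.
suff: gamma x = 0 by move=> H; apply: (F2_lincomb H); rewrite /gamma; char2.
apply: cubic_eq0 => [y z t u|y w3].
  transitivity (polar4 alpha y z t u + d1 * polar4 (@parity n) y z t u
      + d2 * polar4 (fun x => f_O x x) y z t u
      + d3 * polar4 (fun x => f_M x x) y z t u).
    by rewrite /gamma /polar4 /polar3; char2.
  rewrite cub (generating_cubic _ _ _ _ (@f_O_generating n)).
  rewrite (generating_cubic _ _ _ _ (@f_M_generating n)).
  by rewrite /polar4 /polar3 !parityD; char2.
have a0 : a 0%N = 0.
  rewrite /a (_ : initial_vector n 0 = 0) //.
  by apply/rowP => i; rewrite !mxE.
rewrite /gamma alphaE parity_weight f_O_diag f_M_diag.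
case: (weight y) w3 => [|[|[|[|//]]]] _; rewrite ?a0.
- rewrite (_ : 'C(0, 3) = 0%N) // (_ : 'C(0, 2) = 0%N) //.
  by rewrite !mulr0n; char2.
- rewrite (_ : 'C(1, 3) = 0%N) // (_ : 'C(1, 2) = 0%N) //.
  by rewrite !mulr0n mulr1n /d1 /d2; char2.
- rewrite (_ : 'C(2, 3) = 0%N) // (_ : 'C(2, 2) = 1%N) // mulr0n mulr1n.
  by rewrite (_ : 2%:R = 0); [rewrite /d2; char2 | exact: val_inj].
- rewrite (_ : 'C(3, 3) = 1%N) // (_ : 'C(3, 2) = 3%N) // mulr1n.
  rewrite (_ : 3%:R = 1); last exact: val_inj.
  by rewrite /d1 /d2 /d3; char2.
Qed.

Lemma generating_classification f alpha :
    (3 <= n)%N -> is_twist f -> (exists x y z, phi f x y z != 0) ->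
    generating_function f alpha -> Sn_invariant alpha ->
  exists b d, forall x, alpha x = f_base b x x + d * parity x.
Proof.
move=> n3 tw [x0 [y0 [z0 phi_neq0]]] gen inv.
have alpha0 := generating0 tw gen.
have [|d1 [d2 [d3 E]]] := invariant_cubic_decomposition n3 alpha0 inv.
  by move=> *; exact: (generating_cubic _ _ _ _ gen).
(* [parity] does not contribute, and [f_O] and [f_M] have the same [phi]; a nonzero [phi f] thus
   forces exactly one of [d2], [d3] to be 1. *)
have polE x y z : phi f x y z = (d2 + d3) * phi (@f_M n) x y z.
  transitivity (d2 * phi (@f_O n) x y z + d3 * phi (@f_M n) x y z).
    rewrite (proj2 gen) (proj2 (@f_O_generating n)) (proj2 (@f_M_generating n)).
    by rewrite !E !parityD; char2.
  by rewrite phi_f_O; char2.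
move: E polE; elim/F2_ind: d2; elim/F2_ind: d3 => E polE.
- by move: phi_neq0; rewrite polE addr0 mul0r eqxx.
- by exists false, d1 => x; rewrite E /=; char2.
- by exists true, d1 => x; rewrite E /=; char2.
- by move: phi_neq0; rewrite polE addF2xx mul0r eqxx.
Qed.

Lemma generating_parity f alpha d :
    generating_function f (fun x => alpha x + d * parity x) ->
  generating_function f alpha.
Proof.
move=> [bf pf]; split=> [x y|x y z]; rewrite ?bf ?pf !parityD; char2.
Qed.

(** On three distinct basis vectors only their sum has weight three, so a single term of the
    polarization survives. *)
Lemma phi_f_M_neq0 : (3 <= n)%N -> exists x y z, phi (@f_M n) x y z != 0.
Proof.
move=> n3.
have n1 : (0 < n)%N by apply: leq_trans n3.
have n2 : (1 < n)%N by apply: leq_trans n3.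
pose i1 := Ordinal n1; pose i2 := Ordinal n2; pose i3 := Ordinal n3.
pose e i : V := delta_mx 0 i.
have wt2 i j : i != j -> weight (e i + e j) = 2%N.
  move=> ij; rewrite /weight (bigD1 i) //= (bigD1 j) 1?eq_sym //= big1 => [|k].
    by rewrite !mxE !eqxx (negbTE ij) eq_sym (negbTE ij).
  by case/andP => /negbTE ki /negbTE kj; rewrite !mxE ki kj.
have wt3 : weight (e i1 + e i2 + e i3) = 3%N.
  rewrite /weight (bigD1 i1) //= (bigD1 i2) //= (bigD1 i3) //= big1 => [|k].
    by rewrite !mxE.
  by case/andP => /andP[/negbTE k1 /negbTE k2] /negbTE k3; rewrite !mxE k1 k2 k3.
exists (e i1), (e i2), (e i3); rewrite (proj2 (@f_M_generating n)).
by rewrite !f_M_diag wt3 !wt2 ?weight_delta // -!natrD.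
Qed.

Lemma phi_f_base_neq0 b : (3 <= n)%N -> exists x y z, phi (f_base b) x y z != 0.
Proof.
move=> /phi_f_M_neq0[x [y [z H]]]; exists x, y, z.
by case: b; rewrite //= phi_f_O.
Qed.

End Classification.

(** * Symmetric cocycles *)

Section Signs.
Variable K : fieldType.

Definition sign (a : 'F_2) : K := (-1) ^+ (a : nat).

Lemma sign0 : sign 0 = 1. Proof. by []. Qed.

Lemma signD a b : sign (a + b) = sign a * sign b.
Proof.
rewrite /sign.
by elim/F2_ind: a; elim/F2_ind: b; rewrite ?expr0 ?expr1 ?mulr1 ?mul1r ?mulrNN ?mulr1.
Qed.

Lemma sign_neq0 a : sign a != 0.
Proof. by rewrite signr_eq0. Qed.

End Signs.

Section SymmetricCocycles.
Variables (K : fieldType) (n : nat) (g : 'rV['F_2]_n -> 'rV['F_2]_n -> 'F_2).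
Notation V := 'rV['F_2]_n.
Hypothesis g_twist : is_twist g.
(** In the algebra of a twist with this and the next property, products commute and associate. *)
Hypothesis g_sym : forall x y, g x y = g y x.
Hypothesis g_cocycle : forall x y z, phi g x y z = 0.
(** The square of the generator at [delta_mx 0 i] is this sign times the unit, so a character with
    values in [K] needs its square root. *)
Hypothesis g_sqrt : forall i, exists s : K,
  s * s = sign K (g (delta_mx 0 i) (delta_mx 0 i)).

Definition supported_below k (x : V) := forall i : 'I_n, (k <= i)%N -> x 0 i = 0.

Lemma supported_below_split k (kn : (k < n)%N) (x : V) :
    supported_below k.+1 x ->
  exists2 z, supported_below k z & x = z \/ x = z + delta_mx 0 (Ordinal kn).
Proof.
move=> xk; pose i0 := Ordinal kn.
have low z : supported_below k.+1 z -> z 0 i0 = 0 -> supported_below k z.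
  move=> zk zi0 i; rewrite leq_eqVlt => /orP[/eqP ki|]; last exact: zk.
  by rewrite (_ : i = i0) //; apply: val_inj; rewrite /= ki.
elim/F2_ind: {-1}(x 0 i0) (erefl (x 0 i0)) => xi0.
  by exists x; [exact: low | left].
exists (x + delta_mx 0 i0); last first.
  by right; apply/rowP => i; rewrite !coordD -/i0; char2.
apply: low => [i ki|]; rewrite coordD mxE eqxx /=.
  by rewrite xk // add0r (_ : i == i0 = false) // -val_eqE /= gtn_eqF.
by rewrite eqxx xi0 addF2xx.
Qed.

(* A character of the commutative twisted group algebra of [g], built one
   generator [u_{e_i}] at a time by choosing a square root of its square. *)
Lemma symmetric_cocycle_splits :
  exists2 c : V -> K, (forall x, c x != 0) &
    forall x y, c x * c y = sign K (g x y) * c (x + y).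
Proof.
have addvv (x : V) : x + x = 0 by apply/rowP => i; rewrite coordD addF2xx mxE.
have [g0l g0r] := g_twist.
(* Only the value at 0 is carried through the induction; nonvanishing follows at the end, since the
   square of [c x] is a sign times [c 0 = 1]. *)
suff: forall k, (k <= n)%N -> exists2 c : V -> K, c 0 = 1 &
    forall x y, supported_below k x -> supported_below k y ->
      c x * c y = sign K (g x y) * c (x + y).
  case/(_ n (leqnn n)) => c c0 cM.
  have low x : supported_below n x by move=> i; rewrite leqNgt ltn_ord.
  exists c => [x|x y]; last exact: cM.
  apply/eqP => cx; have /eqP := cM x x (low x) (low x).
  by rewrite addvv cx mul0r c0 mulr1 eq_sym (negbTE (sign_neq0 _ _)).
elim=> [|k IH] kn.
  exists (fun=> 1) => // x y x0 y0.
  by rewrite (_ : x = 0) ?g0l ?mul1r //; apply/rowP => i; rewrite x0 ?mxE.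
have [c c0 cM] := IH (ltnW kn).
pose i0 := Ordinal kn; pose e : V := delta_mx 0 i0.
have [s ss] := g_sqrt i0; rewrite -/e in ss.
(* The value at [z + e] is forced by those at [z] and at [e], the latter being [s]; for [x] with
   nonzero coordinate [i0], the vector [z] is [x + e]. *)
pose c' (x : V) := if x 0 i0 == 0 then c x else sign K (g (x + e) e) * c (x + e) * s.
have c'0 z : supported_below k z -> c' z = c z.
  by move=> zk; rewrite /c' zk ?eqxx.
have c'1 z : supported_below k z -> c' (z + e) = sign K (g z e) * c z * s.
  by move=> zk; rewrite /c' -addrA addvv addr0 coordD zk // mxE !eqxx.
have lowD z w : supported_below k z -> supported_below k w ->
    supported_below k (z + w).
  by move=> zk wk i ki; rewrite coordD zk ?wk ?addr0.
have mixed z w : supported_below k z -> supported_below k w ->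
    c' (z + e) * c' w = sign K (g (z + e) w) * c' (z + e + w).
  move=> zk wk; rewrite (addrAC z) !c'1 ?c'0 //; last exact: lowD.
  rewrite (mulrAC _ s) -(mulrA (sign _ _) (c z)) cM // !mulrA -!signD.
  congr (sign K _ * _ * _).
  (* In the sum of these two cocycle identities the terms [g z (e + w)] cancel, and so do [g e w]
     and [g w e] by symmetry. *)
  apply: (F2_lincomb (g_cocycle z e w)).
  apply: (F2_lincomb (g_cocycle z w e)).
  by rewrite /phi (addrC e w) (g_sym e w); char2.
have low0 : supported_below k 0 by move=> i _; rewrite mxE.
exists c' => [|x y]; first by rewrite c'0.
case/(supported_below_split kn) => z zk; rewrite -/i0 -/e => zE.
case/(supported_below_split kn) => w wk; rewrite -/i0 -/e => wE.
case: zE => ->; case: wE => ->.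
- by rewrite !c'0 ?cM //; exact: lowD.
- by rewrite mulrC mixed // g_sym (addrC z).
- exact: mixed.
have zwE : z + e + (w + e) = z + w.
  by rewrite addrACA addvv addr0.
(* The two copies of [e] cancel in the argument, while the two factors [s] multiply to the sign of
   [g e e]. *)
rewrite zwE !c'1 // c'0; last exact: lowD.
rewrite mulrACA ss [X in X * _]mulrACA cM // mulrAC !mulrA -!signD.
congr (sign K _ * _).
apply: (F2_lincomb (g_cocycle z e (w + e))).
apply: (F2_lincomb (g_cocycle e e w)).
rewrite /phi addvv g0l (addrC e (w + e)) -(addrA w) addvv !addr0.
by rewrite (addrC e w) (g_sym w e); char2.
Qed.

End SymmetricCocycles.

(** * Twisted group algebras *)

Section TwistedGroupAlgebras.
Variables (K : fieldType) (n : nat).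
Notation V := 'rV['F_2]_n.
Implicit Types (f g : V -> V -> 'F_2) (x y z : V).

Lemma tga_mulE f (a b : tga K f) :
  tga_mul a b = \sum_x \sum_y
    (tga_coord a x * tga_coord b y * sign K (f x y)) *: tga_basis K f (x + y).
Proof. by []. Qed.

Lemma tga_coordE f (a : tga K f) x : tga_coord a x = (a : {ffun V -> K^o}) x.
Proof. by []. Qed.

Lemma tga_basis_coord f x y : tga_coord (tga_basis K f x) y = (y == x)%:R.
Proof. by rewrite /tga_coord ffunE. Qed.

Lemma tga_ext f (a b : tga K f) : (forall x, tga_coord a x = tga_coord b x) -> a = b.
Proof. by move=> ab; apply/ffunP. Qed.

Lemma tga_coordD f (a b : tga K f) x :
  tga_coord (a + b) x = tga_coord a x + tga_coord b x.
Proof. by rewrite /tga_coord ffunE. Qed.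

Lemma tga_coordZ f k (a : tga K f) x : tga_coord (k *: a) x = k * tga_coord a x.
Proof. by rewrite /tga_coord ffunE. Qed.

Lemma tga_coord_sum f I r (P : pred I) (F : I -> tga K f) x :
  tga_coord (\sum_(i <- r | P i) F i) x = \sum_(i <- r | P i) tga_coord (F i) x.
Proof.
apply: (big_morph (fun a : tga K f => tga_coord a x)) => [a b|].
  exact: tga_coordD.
by rewrite /tga_coord ffunE.
Qed.

Lemma tga_expand f (a : tga K f) : a = \sum_x tga_coord a x *: tga_basis K f x.
Proof.
apply: tga_ext => y; rewrite tga_coord_sum (bigD1 y) //= big1 => [|x xy].
  by rewrite tga_coordZ tga_basis_coord eqxx mulr1 addr0.
by rewrite tga_coordZ tga_basis_coord eq_sym (negbTE xy) mulr0.
Qed.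

(** Reduces multilinear identities to basis vectors, one variable at a time. Linearity is a
    hypothesis on bare functions so that products with a fixed factor fit directly. *)
Lemma tga_linear_ext f (W : lmodType K) (h1 h2 : tga K f -> W) :
    linear h1 -> linear h2 ->
    (forall x, h1 (tga_basis K f x) = h2 (tga_basis K f x)) -> h1 =1 h2.
Proof.
move=> lin1 lin2 eqh a.
pose H1 : {linear tga K f -> W} :=
  HB.pack h1 (GRing.isLinear.Build K (tga K f) W *:%R h1 lin1).
pose H2 : {linear tga K f -> W} :=
  HB.pack h2 (GRing.isLinear.Build K (tga K f) W *:%R h2 lin2).
rewrite (tga_expand a) -[h1]/(H1 : _ -> _) -[h2]/(H2 : _ -> _) !linear_sum.
by apply: eq_bigr => x _; rewrite !linearZ /=; congr (_ *: _); exact: eqh.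
Qed.

Lemma tga_mul_linearl f (b : tga K f) : linear (fun a => tga_mul a b).
Proof.
move=> k a a'; rewrite !tga_mulE scaler_sumr -big_split; apply: eq_bigr => x _.
rewrite scaler_sumr -big_split; apply: eq_bigr => y _ /=.
by rewrite tga_coordD tga_coordZ scalerA -scalerDl !mulrDl !mulrA.
Qed.

Lemma tga_mul_linearr f (a : tga K f) : linear (tga_mul a).
Proof.
move=> k b b'; rewrite !tga_mulE scaler_sumr -big_split; apply: eq_bigr => x _.
rewrite scaler_sumr -big_split; apply: eq_bigr => y _ /=.
by rewrite tga_coordD tga_coordZ scalerA -scalerDl mulrDr mulrDl !mulrA (mulrC k).
Qed.

Lemma tga_mul_basis f x y :
  tga_mul (tga_basis K f x) (tga_basis K f y)
  = sign K (f x y) *: tga_basis K f (x + y).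
Proof.
rewrite tga_mulE (bigD1 x) //= addrC big1 => [|z zx]; last first.
  apply: big1 => t _.
  by rewrite tga_basis_coord (negbTE zx) !mul0r scale0r.
rewrite add0r (bigD1 y) //= addrC big1 => [|z zy]; last first.
  by rewrite (tga_basis_coord _ _ z) (negbTE zy) mulr0 mul0r scale0r.
by rewrite !tga_basis_coord !eqxx !mul1r !(add0r, addr0).
Qed.

Lemma tga_mulZl f k (a b : tga K f) : tga_mul (k *: a) b = k *: tga_mul a b.
Proof.
have lin0 : tga_mul 0 b = 0 :> tga K f.
  by have := tga_mul_linearl b (-1) 0 0; rewrite scaler0 addr0 scaleN1r addNr.
by have := tga_mul_linearl b k a 0; rewrite lin0 !addr0.
Qed.

Lemma tga_mulZr f k (a b : tga K f) : tga_mul a (k *: b) = k *: tga_mul a b.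
Proof.
have lin0 : tga_mul a 0 = 0 :> tga K f.
  by have := tga_mul_linearr a (-1) 0 0; rewrite scaler0 addr0 scaleN1r addNr.
by have := tga_mul_linearr a k b 0; rewrite lin0 !addr0.
Qed.

(** The exponents of the two bracketings add up to [phi], which thus measures the failure of
    associativity. *)
Lemma tga_mul_basisA f x y z :
  tga_mul (tga_basis K f x) (tga_mul (tga_basis K f y) (tga_basis K f z))
  = sign K (phi f x y z) *: tga_mul
      (tga_mul (tga_basis K f x) (tga_basis K f y)) (tga_basis K f z).
Proof.
rewrite (tga_mul_basis f x y) (tga_mul_basis f y z) tga_mulZl tga_mulZr.
rewrite !tga_mul_basis !scalerA -!signD addrA; congr (sign K _ *: _).
by rewrite /phi; char2.
Qed.

Lemma tga_associative f : (forall x y z, phi f x y z = 0) -> associative (@tga_mul K n f).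
Proof.
move=> phi0 a b c.
have comp (W1 W2 W3 : lmodType K) (h : W2 -> W3) (h' : W1 -> W2) :
  linear h -> linear h' -> linear (fun a => h (h' a)).
  by move=> lh lh' k u v; rewrite lh' lh.
apply: (tga_linear_ext (h1 := fun a => tga_mul a (tga_mul b c))
  (h2 := fun a => tga_mul (tga_mul a b) c)) => [||x].
- exact: tga_mul_linearl.
- by apply: (comp _ _ _ (fun a => tga_mul a c)) => //; exact: tga_mul_linearl.
apply: (tga_linear_ext (h1 := fun b => tga_mul _ (tga_mul b c))
  (h2 := fun b => tga_mul (tga_mul _ b) c)) => [||y].
- by apply: comp; [exact: tga_mul_linearr | exact: tga_mul_linearl].
- apply: (comp _ _ _ (fun a => tga_mul a c)).
    exact: tga_mul_linearl.
  exact: tga_mul_linearr.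
apply: (tga_linear_ext (h1 := fun c => tga_mul _ (tga_mul _ c))
  (h2 := fun c => tga_mul _ c)) => [||z].
- by apply: comp; exact: tga_mul_linearr.
- exact: tga_mul_linearr.
by rewrite tga_mul_basisA phi0 sign0 scale1r.
Qed.

(** The group is finite, so a triple with nonzero [phi] can be searched for; if there is none, the
    algebra is associative. *)
Lemma nonassociative_phi f :
  nonassociative K f -> exists x y z, phi f x y z != 0.
Proof.
move=> nonassoc.
have [/existsP[x /existsP[y /existsP[z phi_neq0]]]|all0] :=
  boolP [exists x : V, [exists y : V, [exists z : V, phi f x y z != 0]]].
  by exists x, y, z.
case: nonassoc; apply: tga_associative => x y z; apply/eqP.
apply: contraNT all0 => phi_neq0.
by apply/existsP; exists x; apply/existsP; exists y; apply/existsP; exists z.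
Qed.

Lemma phi_nonassociative f :
    1 != -1 :> K -> (exists x y z, phi f x y z != 0) -> nonassociative K f.
Proof.
move=> neq1N1 [x [y [z phi_neq0]]] assoc.
have := tga_mul_basisA f x y z.
have -> : phi f x y z = 1 by move: phi_neq0; elim/F2_ind: (phi f x y z).
rewrite assoc !(tga_mul_basis, tga_mulZl) => /(congr1 (fun a => tga_coord a (x + y + z))).
rewrite !tga_coordZ tga_basis_coord eqxx => /eqP.
have sign1 : sign K 1 = -1 by [].
(* Associativity would make [e], a product of signs, equal to its opposite. *)
rewrite sign1 mulr1; set e := _ * sign K _.
rewrite -subr_eq0 -{1}[e]mul1r -mulrBl mulf_eq0 subr_eq0 (negbTE neq1N1).
by rewrite mulf_eq0 !(negbTE (sign_neq0 _ _)).
Qed.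

(** A monomial map: basis vectors are permuted by [s] and rescaled by [c]. Coordinates are pulled
    back, hence the inverse permutation. *)
Definition tga_relabel f g (s : 'S_n) (c : V -> K) (a : tga K f) : tga K g :=
  [ffun y => c (col_perm s^-1 y) * tga_coord a (col_perm s^-1 y) : K^o].

Lemma tga_relabel_linear f g s c : linear (@tga_relabel f g s c).
Proof.
move=> k a b; apply: tga_ext => x; rewrite tga_coordD tga_coordZ.
by rewrite !tga_coordE !ffunE tga_coordD tga_coordZ mulrDr mulrCA.
Qed.

HB.instance Definition _ f g s c := GRing.isLinear.Build K (tga K f) (tga K g)
  *:%R (@tga_relabel f g s c) (@tga_relabel_linear f g s c).

Lemma col_permK (s : 'S_n) : cancel (@col_perm 'F_2 1 n s) (col_perm s^-1).
Proof. by move=> x; rewrite -col_permM mulVg col_perm1. Qed.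

Lemma col_permVK (s : 'S_n) : cancel (@col_perm 'F_2 1 n s^-1) (col_perm s).
Proof. by move=> x; rewrite -col_permM mulgV col_perm1. Qed.

Lemma tga_relabel_basis f g s c x :
  tga_relabel g s c (tga_basis K f x) = c x *: tga_basis K g (col_perm s x).
Proof.
apply: tga_ext => y; rewrite tga_coordZ tga_basis_coord.
rewrite tga_coordE ffunE tga_basis_coord.
have [->|ysx] := eqVneq y (col_perm s x); first by rewrite col_permK eqxx.
rewrite (_ : col_perm s^-1 y == x = false) ?mulr0 //.
by apply: contraNF ysx => /eqP <-; rewrite col_permVK.
Qed.

(** Nonzero scalars make the map invertible, and by bilinearity multiplicativity need only be
    checked on basis vectors, where it is the second hypothesis. *)
Lemma tga_relabel_isomorphism f g (s : 'S_n) (c : V -> K) :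
    (forall x, c x != 0) ->
    (forall x y, c x * c y * sign K (g (col_perm s x) (col_perm s y))
                 = sign K (f x y) * c (x + y)) ->
  tga_isomorphic K f g.
Proof.
move=> c0 cM; exists (tga_relabel g s c : {linear tga K f -> tga K g}); split.
- pose inv (b : tga K g) : tga K f :=
    [ffun x => (c x)^-1 * tga_coord b (col_perm s x) : K^o].
  exists inv => a; apply: tga_ext => x; rewrite /tga_coord !ffunE /tga_coord !ffunE.
    by rewrite col_permK mulKf.
  by rewrite col_permVK mulVKf.
- pose h : {linear tga K f -> tga K g} := tga_relabel g s c.
  move=> a b.
  apply: (tga_linear_ext (h1 := fun a => h (tga_mul a b))
    (h2 := fun a => tga_mul (h a) (h b))) => [k u v|k u v|x].
  + by rewrite tga_mul_linearl linearP.
  + by rewrite linearP tga_mul_linearl.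
  apply: (tga_linear_ext (h1 := fun b => h (tga_mul _ b))
    (h2 := fun b => tga_mul _ (h b))) => [k u v|k u v|y].
  + by rewrite tga_mul_linearr linearP.
  + by rewrite linearP tga_mul_linearr.
  rewrite tga_mul_basis linearZ /= !tga_relabel_basis tga_mulZl tga_mulZr.
  by rewrite tga_mul_basis !scalerA cM linearD.
- by move=> x; exists (col_perm s x), (c x); exact: tga_relabel_basis.
Qed.

End TwistedGroupAlgebras.

(** * Isomorphisms from equality of generating functions *)

Section Isomorphisms.
Variables (K : fieldType) (n : nat).
Notation V := 'rV['F_2]_n.
Implicit Types (f g : V -> V -> 'F_2) (alpha : V -> 'F_2) (x y z : V).

Lemma same_generating_isomorphic f g (s : 'S_n) alpha :
    is_twist f -> is_twist g ->
    generating_function f alpha -> generating_function g alpha ->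
    Sn_invariant alpha ->
    (forall i, exists r : K, r * r = sign K
      (f (delta_mx 0 i) (delta_mx 0 i)
       + g (col_perm s (delta_mx 0 i)) (col_perm s (delta_mx 0 i)))) ->
  tga_isomorphic K f g.
Proof.
move=> tf tg [bf pf] [bg pg] inv roots.
pose pi (x : V) : V := col_perm s x.
have piD x y : pi (x + y) = pi x + pi y by exact: linearD.
have inv_pi x : alpha (pi x) = alpha x by exact: inv.
(* By invariance of [alpha], [g] transported along [s] has the same [beta] and [phi] as [f]; so [h]
   is a symmetric cocycle, and a character of it supplies the scalars. *)
pose h x y := f x y + g (pi x) (pi y).
have h_twist : is_twist h.
  case: tf tg => [f0l f0r] [g0l g0r].
  by split=> x; rewrite /h /pi linear0 ?(f0l, f0r, g0l, g0r) addr0.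
have h_sym x y : h x y = h y x.
  have := bg (pi x) (pi y).
  rewrite -piD !inv_pi -bf /beta => H; apply: (F2_lincomb H).
  by rewrite /h; char2.
have h_cocycle x y z : phi h x y z = 0.
  have := pg (pi x) (pi y) (pi z).
  rewrite -!piD !inv_pi -pf /phi -!piD => H; apply: (F2_lincomb H).
  by rewrite /h /phi; char2.
have [c c_neq0 cM] := symmetric_cocycle_splits h_twist h_sym h_cocycle roots.
apply: (tga_relabel_isomorphism (s := s) c_neq0) => x y.
rewrite cM mulrAC -signD /h -/(pi x) -/(pi y); congr (sign K _ * _); char2.
Qed.

(** Convertible to [f_Op] or [f_Mp] according to [b]. *)
Definition f_base_diagonal b p x y : 'F_2 := f_base b x y + diagonal_form p x y.

Lemma f_base_diagonal_twist b p : is_twist (f_base_diagonal b p).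
Proof.
apply: twist_add; first exact: f_base_twist.
exact: biadditive_twist (@diagonal_form_biadditive n p).
Qed.

Lemma f_base_diagonal_generating b p :
  generating_function (f_base_diagonal b p) (fun x => f_base b x x).
Proof. exact: generating_diagonal (f_base_generating n b). Qed.

Lemma f_base_nonassociative b : 1 != -1 :> K -> (3 <= n)%N ->
  nonassociative_with_invariant_generating_function K (@f_base n b).
Proof.
move=> neq1N1 n3; split; first exact: f_base_twist.
  by apply: phi_nonassociative => //; exact: phi_f_base_neq0.
by exists (fun x => f_base b x x);
  [exact: f_base_generating | exact: f_base_invariant].
Qed.

Lemma f_base_diagonal_nonassociative b p : 1 != -1 :> K -> (3 <= n)%N ->
  nonassociative_with_invariant_generating_function K (f_base_diagonal b p).
Proof.
move=> neq1N1 n3; split; first exact: f_base_diagonal_twist.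
  apply: phi_nonassociative => //.
  have [x [y [z H]]] := phi_f_base_neq0 b n3; exists x, y, z.
  by rewrite phi_add (biadditive_phi _ _ _ (diagonal_form_biadditive n p)) addr0.
by exists (fun x => f_base b x x);
  [exact: f_base_diagonal_generating | exact: f_base_invariant].
Qed.

Lemma nonassociative_generating f : (3 <= n)%N ->
    nonassociative_with_invariant_generating_function K f ->
  exists b, generating_function f (fun x => f_base b x x).
Proof.
move=> n3 [tw /nonassociative_phi phi_neq0 [alpha gen inv]].
have [b [d E]] := generating_classification n3 tw phi_neq0 gen inv.
exists b; apply: (@generating_parity _ _ _ d).
by case: gen => [bf pf]; split=> *; rewrite ?bf ?pf !E.
Qed.

(** With a square root of -1 both signs are squares, so the identity permutation works. *)
Lemma isomorphic_f_base f : (3 <= n)%N ->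
    (exists r : K, r * r = -1) ->
    nonassociative_with_invariant_generating_function K f ->
  exists b, tga_isomorphic K f (@f_base n b).
Proof.
move=> n3 [r rr] Hf; have [b gen] := nonassociative_generating n3 Hf.
case: Hf => tw _ _; exists b.
apply: (same_generating_isomorphic (s := 1%g) tw (f_base_twist n b) gen).
- exact: f_base_generating.
- exact: f_base_invariant.
move=> i; elim/F2_ind: (_ + _); first by exists 1; rewrite mulr1.
by exists r.
Qed.

Lemma isomorphic_f_base_diagonal f : (3 <= n)%N ->
    nonassociative_with_invariant_generating_function K f ->
  exists2 p, (p <= n)%N & exists b, tga_isomorphic K f (f_base_diagonal b p).
Proof.
move=> n3 Hf; have [b gen] := nonassociative_generating n3 Hf.
case: Hf => tw _ _.
(* [eps] marks the basis vectors whose squares have different signs under the two twists; its weight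
   is the required [p], and [s] moves the marked coordinates to the front. *)
pose eps : V := \row_i (f (delta_mx 0 i) (delta_mx 0 i)
                        + f_base b (delta_mx 0 i) (delta_mx 0 i)).
have [s Es] : exists s : 'S_n, initial_vector n (weight eps) = col_perm s eps.
  by apply: same_weight_perm; rewrite weight_initial_vector ?weight_le.
exists (weight eps); first exact: weight_le.
exists b.
apply: (same_generating_isomorphic (s := s) tw (f_base_diagonal_twist b _) gen).
- exact: f_base_diagonal_generating.
- exact: f_base_invariant.
move=> i; exists 1; rewrite mulr1 -(sign0 K); congr sign.
have diagE : diagonal_form (weight eps) (col_perm s (delta_mx 0 i))
    (col_perm s (delta_mx 0 i)) = eps 0 i.
  (* After reindexing by [s], the condition that [j] is below the weight of [eps] says that [eps] is
     1 at [s j]. *)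
  transitivity (\sum_j eps 0 j * (delta_mx 0 i : V) 0 j).
    rewrite [RHS](reindex_inj (@perm_inj _ s)) /diagonal_form big_mkcond.
    apply: eq_bigr => j _.
    have -> : eps 0 (s j) = (j < weight eps)%N%:R.
      by move/rowP/(_ j): Es; rewrite !mxE => <-.
    by rewrite mulF2_xx [col_perm _ _ _ _]mxE; case: ifP; rewrite ?mul1r ?mul0r.
  rewrite (bigD1 i) //= big1 => [|j ji].
    by rewrite addr0 [X in _ * X]mxE !eqxx mulr1.
  by rewrite [X in _ * X]mxE (negbTE ji) andbF mulr0.
(* The diagonal term cancels the mismatch recorded in [eps], so every sign left is 1 and has 1 as a
   root, in any field. *)
rewrite /f_base_diagonal diagE mxE (@f_base_invariant n b s); char2.
Qed.

End Isomorphisms.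

Theorem proposition4p4 (R : realType) (n : nat) (hn : (3 <= n)%N) :
  [/\ nonassociative_with_invariant_generating_function R[i] (@f_O n),
      nonassociative_with_invariant_generating_function R[i] (@f_M n),
      (forall p q : nat, (p + q)%N = n ->
         nonassociative_with_invariant_generating_function R (@f_Op n p)
         /\ nonassociative_with_invariant_generating_function R (@f_Mp n p)),
      (forall f : 'rV['F_2]_n -> 'rV['F_2]_n -> 'F_2,
         nonassociative_with_invariant_generating_function R[i] f ->
         tga_isomorphic R[i] f (@f_O n) \/ tga_isomorphic R[i] f (@f_M n)) &
      (forall f : 'rV['F_2]_n -> 'rV['F_2]_n -> 'F_2,
         nonassociative_with_invariant_generating_function R f ->
         exists p q : nat, (p + q)%N = n /\
           (tga_isomorphic R f (@f_Op n p) \/ tga_isomorphic R f (@f_Mp n p)))].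
Proof.
have neq1N1 (F : numDomainType) : 1 != -1 :> F.
  by rewrite -subr_eq0 opprK -(natrD F 1 1) pnatr_eq0.
split.
- exact: (f_base_nonassociative true (neq1N1 _) hn).
- exact: (f_base_nonassociative false (neq1N1 _) hn).
- move=> p q _; split.
    exact: (f_base_diagonal_nonassociative true p (neq1N1 _) hn).
  exact: (f_base_diagonal_nonassociative false p (neq1N1 _) hn).
- move=> f Hf.
  have sqrtN1 : exists r : R[i], r * r = -1 by exists 'i; rewrite -expr2 sqrCi.
  have [[] iso] := isomorphic_f_base hn sqrtN1 Hf; first by left.
  by right.
- move=> f Hf; have [p pn [b iso]] := isomorphic_f_base_diagonal hn Hf.
  exists p, (n - p)%N; split; first exact: subnKC.
  by case: b iso; [left | right].
Qed.
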